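(* In the setting described in the context ($(X,d)$ compact, doubling and uniformly perfect), assume that there exist $p>0$ and a function $\rho:\mathcal S\to(0,+\infty)$ satisfying: (H1) there exist $0<\eta_-\le\eta_+<1$ such that $\eta_-\le\rho(B)\le\eta_+$ for all $B\in\mathcal S$; (H2) there exists $K_0\ge1$ such that $\pi(B)\le K_0\,\pi(B')$ for all $B,B'\in\mathcal S$ with $B\sim B'$; (H4) there exists $K_2\ge1$ such that for all $m\ge0$, $B\in\mathcal S_m$ and $n>m$, $K_2^{-1}\pi(B)^p\le\sum_{B'\in D_n(B)}\pi(B')^p\le K_2\,\pi(B)^p$; (H3') for all $k\ge0$ and all $B\in\mathcal S_k$, if $\gamma\in\Gamma_{k+1}(B)$, then $L_h(\gamma,\rho)\ge1$. Then $\rho$ also satisfies: (H3) there exist $\alpha\in[2,\lambda/4]$ and $K_1\ge1$ such that for any pair of distinct points $x,y\in X$ there exists $n_0\ge1$ such that if $n\ge n_0$ and $\gamma\in\Gamma_n(x,y)$, then $L_\rho(\gamma)\ge K_1^{-1}\,\pi(c_\alpha(x,y))$.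
   Context: Setting. $(X,d)$ is a compact metric space (with at least two points), doubling (there is $K_D\ge1$ such that every ball can be covered by at most $K_D$ balls of half the radius) and uniformly perfect with constant $K_P>1$ ($B(x,r)\setminus B(x,K_P^{-1}r)\ne\emptyset$ for all $x$ and $0<r\le\mathrm{diam}\,X$); $B(x,r)$ is the open ball. Fix $\kappa\ge1$, $\lambda\ge32$ and $a\ge6\kappa^2\max\{\lambda,K_P\}$; put $r_n=a^{-n}$. For $n\ge1$, $\mathcal S_n$ is a finite covering of $X$ such that each $B\in\mathcal S_n$ has a chosen center $x_B\in X$ with $B(x_B,\kappa^{-1}r_n)\subset B\subset B(x_B,\kappa r_n)$, and the balls $B(x_B,\kappa^{-1}r_n)$, $B\in\mathcal S_n$, are pairwise disjoint. $\mathcal S_0=\{w\}$, where $w$ represents the covering $\{X\}$ and has a center $x_w\in X$, with the normalization $X=B(x_w,\kappa)$. $\mathcal S=\bigsqcup_{n\ge0}\mathcal S_n$. For $\mu>0$ and $B\in\mathcal S_n$, $\mu\cdot B:=B(x_B,\mu\kappa r_n)$. For $B,B'$ in the same $\mathcal S_n$, $B\sim B'$ means $\lambda\cdot B\cap\lambda\cdot B'\neq\emptyset$ (so $B\sim B$). Parents and graph. Let $X_n=\{x_B:B\in\mathcal S_n\}$ and $V_n(B)=\{y\in X:d(y,x_B)=\mathrm{dist}(y,X_n)\}$. For each $B'\in\mathcal S_{n+1}$ choose once and for all one $B\in\mathcal S_n$ with $x_{B'}\in V_n(B)$, called its parent. For $B\in\mathcal S_m$, $n>m$, $D_n(B)$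 is the set of $B'\in\mathcal S_n$ having $B$ as their ancestor in $\mathcal S_m$. $Z_d$ is the graph with vertex set $\mathcal S$, horizontal edges between distinct $B\sim B'$ of the same level, and vertical edges between each element of $\mathcal S_{n+1}$ and its parent. $[w,B]$ is the vertical path from $w$ to $B$ through the successive ancestors of $B$. Weights. $\pi(B)=\prod\rho(B')$ over all vertices $B'$ of $[w,B]$. For an edge path $\gamma$ in $Z_d$ with vertices $B_1,\dots,B_N$, $L_\rho(\gamma)=\sum_{i=1}^N\pi(B_i)$. For $\alpha>1$ and distinct $x,y\in X$, let $m$ be the maximal level for which some $B\in\mathcal S_m$ satisfies $x,y\in\alpha\cdot B$; $c_\alpha(x,y)=\{B\in\mathcal S_m:x,y\in\alpha\cdot B\}$ and $\pi(c_\alpha(x,y))=\max_{B\in c_\alpha(x,y)}\pi(B)$. $\Gamma_n(x,y)$ is the family of edge paths in $Z_d$ joining two elements $B,B'\in\mathcal S_n$ with $x\in B$, $y\in B'$. Horizontal paths. A horizontal path of level $k$ is an edge path of $Z_d$ with all vertices $B_1,\dots,B_N\in\mathcal S_k$; $z_i$ denotes the center of $B_i$. For $B\in\mathcal S_k$, $\Gamma_{k+1}(B)$ is the family of horizontal paths of level $k+1$ such that $z_1\in B$ (with $w$ identified with $X$ if $k=0$), $z_i\in2\cdot B$ for $i=2,\dots,N-1$ and $z_N\in X\setminus2\cdot B$. Put $\rho^*(B)=\min\{\rho(B'):B'\sim B\}$ and, for a horizontal path, $L_h(\gamma,\rho)=\sum_{j=1}^{N-1}\min\{\rho^*(B_j),\rho^*(B_{j+1})\}$.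 *)

(* Defs.v *)
From HB Require Import structures.
From mathcomp Require Import all_boot all_order all_algebra.
From mathcomp Require Import all_classical all_reals all_analysis.

Set Implicit Arguments.
Unset Strict Implicit.
Unset Printing Implicit Defensive.

Import Order.TTheory GRing.Theory Num.Theory.

Local Open Scope classical_set_scope.
Local Open Scope ring_scope.

Section metric.
Context {R : realType} {X : metricType R}.

Definition dist_to (y : X) (A : set X) : R := inf [set mdist y z | z in A].

Definition diameter (A : set X) : R :=
  sup [set mdist u.1 u.2 | u in A `*` A].

End metric.

Definition doubling (R : realType) (X : metricType R) : Prop :=
  exists KD : nat, (1 <= KD)%N /\
    forall (x : X) (r : R), 0 < r ->
      exists s : seq X, (size s <= KD)%N /\
        ball x r `<=` \bigcup_(y in [set` s]) ball y (r / 2).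

Definition uniformly_perfect (R : realType) (X : metricType R) (KP : R) : Prop :=
  forall (x : X) (r : R), 0 < r -> r <= diameter [set: X] ->
    (ball x r `\` ball x (KP^-1 * r)) !=set0.

(* The elements of level n are indexed by the finite type [cell n], [carrier B]
   being the subset of X named B.  [carrier_inj] says that this indexing is
   without repetition, as for a set of subsets; r_n is [a ^- n]. *)
Record coverings (R : realType) (X : metricType R) (kappa a : R) := Coverings {
  cell : nat -> finType ;
  carrier : forall n, cell n -> set X ;
  center : forall n, cell n -> X ;
  carrier_inj : forall n, injective (@carrier n) ;
  root : cell 0 ;
  rootP : forall B : cell 0, B = root ;
  carrier_root : carrier root = [set: X] ;
  ball_root : ball (center root) kappa = [set: X] ;
  carrier_cover : forall n, (1 <= n)%N ->
    \bigcup_(B in [set: cell n]) carrier B = [set: X] ;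
  ball_sub_carrier : forall n (B : cell n), (1 <= n)%N ->
    ball (center B) (kappa^-1 * a ^- n) `<=` carrier B ;
  carrier_sub_ball : forall n (B : cell n), (1 <= n)%N ->
    carrier B `<=` ball (center B) (kappa * a ^- n) ;
  disjoint_balls : forall n, (1 <= n)%N ->
    trivIset [set: cell n] (fun B => ball (center B) (kappa^-1 * a ^- n))
}.

Arguments carrier {R X kappa a} c {n} B.
Arguments center {R X kappa a} c {n} B.

Section covering_theory.
Context {R : realType} {X : metricType R} {kappa a : R}.
Variable C : coverings X kappa a.

Definition vertex : Type := {n : nat & cell C n}.

Definition vtx n (B : cell C n) : vertex := Tagged (cell C) B.

(* mu . B *)
Definition scaled (mu : R) n (B : cell C n) : set X :=
  ball (center C B) (mu * kappa * a ^- n).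

Definition sim (lambda : R) n (B B' : cell C n) : bool :=
  `[< (scaled lambda B `&` scaled lambda B') !=set0 >].

(* V_n(B) *)
Definition nearest n (B : cell C n) : set X :=
  [set y | mdist y (center C B) = dist_to y (range (@center _ _ _ _ C n))].

Definition parent_choice (parent : forall n, cell C n.+1 -> cell C n) : Prop :=
  forall n (B' : cell C n.+1), nearest (parent n B') (center C B').

Section graph.
Variables (lambda : R) (parent : forall n, cell C n.+1 -> cell C n).

Definition horizontal_edge (u v : vertex) : Prop :=
  u <> v /\ exists n (B B' : cell C n),
    [/\ u = vtx B, v = vtx B' & sim lambda B B'].

Definition vertical_edge (u v : vertex) : Prop :=
  exists n (B : cell C n.+1), u = vtx B /\ v = vtx (parent B).

(* Adjacency in Z_d. A nonempty edge path B_1, ..., B_N is a pair (B_1, s)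
   such that [path Zd B_1 s], where s = B_2, ..., B_N. *)
Definition Zd : rel vertex := fun u v =>
  `[< horizontal_edge u v \/ vertical_edge u v \/ vertical_edge v u >].

(* [w, B], listed from w to B *)
Fixpoint vertical_path n : cell C n -> seq vertex :=
  match n with
  | 0 => fun B => [:: vtx B]
  | n'.+1 => fun B => rcons (vertical_path (parent B)) (vtx B)
  end.

(* D_n(B) *)
Definition descendants m (B : cell C m) n : {set cell C n} :=
  [set B' : cell C n | vtx B \in vertical_path B']%SET.

(* Gamma_n(x, y) *)
Definition joining_path n (x y : X) (u : vertex) (s : seq vertex) : Prop :=
  path Zd u s /\ exists B B' : cell C n,
    [/\ u = vtx B, last u s = vtx B', carrier C B x & carrier C B' y].

Definition horizontal_path k (B1 : cell C k) (s : seq (cell C k)) : Prop :=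
  path Zd (vtx B1) [seq vtx B | B <- s].

(* Gamma_{k+1}(B); indices start at 0 in [nth]. *)
Definition crossing_path k (B : cell C k)
    (B1 : cell C k.+1) (s : seq (cell C k.+1)) : Prop :=
  [/\ horizontal_path B1 s,
      carrier C B (center C B1),
      forall i, (0 < i)%N -> (i.+1 < size (B1 :: s))%N ->
        scaled 2 B (center C (nth B1 (B1 :: s) i))
    & ~ scaled 2 B (center C (last B1 s))].

Section weights.
Variable rho : vertex -> R.

(* pi(B) *)
Definition weight n (B : cell C n) : R := \prod_(v <- vertical_path B) rho v.

Definition rho_length (u : vertex) (s : seq vertex) : R :=
  \sum_(v <- u :: s) weight (tagged v).

Definition common_level (alpha : R) (x y : X) (m : nat) : Prop :=
  exists B : cell C m, scaled alpha B x /\ scaled alpha B y.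

(* The maximum exists when x != y, 1 < a and 1 <= alpha: level 0 qualifies
   by [ball_root], and the radii of the scaled balls tend to 0. *)
Definition max_common_level (alpha : R) (x y : X) : nat :=
  xget 0%N [set m | common_level alpha x y m /\
    forall k, common_level alpha x y k -> (k <= m)%N].

(* pi(c_alpha(x, y)); the neutral value 0 is harmless as weights are positive. *)
Definition weight_common (alpha : R) (x y : X) : R :=
  \big[Num.max/0]_(B : cell C (max_common_level alpha x y) |
    `[< scaled alpha B x /\ scaled alpha B y >]) weight B.

(* B itself is one of the B' ~ B, so starting from rho B is harmless. *)
Definition rho_star n (B : cell C n) : R :=
  \big[Num.min/rho (vtx B)]_(B' : cell C n | sim lambda B' B) rho (vtx B').

Definition horizontal_length k (B1 : cell C k) (s : seq (cell C k)) : R :=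
  \sum_(j < size s)
    Num.min (rho_star (nth B1 (B1 :: s) j)) (rho_star (nth B1 (B1 :: s) j.+1)).

Definition H1 : Prop :=
  exists eta_minus eta_plus : R,
    [/\ 0 < eta_minus, eta_minus <= eta_plus, eta_plus < 1
      & forall v : vertex, eta_minus <= rho v <= eta_plus].

Definition H2 : Prop :=
  exists K0 : R, 1 <= K0 /\
    forall n (B B' : cell C n), sim lambda B B' -> weight B <= K0 * weight B'.

Definition H3 : Prop :=
  exists alpha K1 : R,
    [/\ 2 <= alpha, alpha <= lambda / 4, 1 <= K1
      & forall x y : X, x <> y ->
          exists n0 : nat, (1 <= n0)%N /\
            forall n u s, (n0 <= n)%N -> joining_path n x y u s ->
              K1^-1 * weight_common alpha x y <= rho_length u s].

Definition H4 (p : R) : Prop :=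
  exists K2 : R, 1 <= K2 /\
    forall m (B : cell C m) n, (m < n)%N ->
      K2^-1 * weight B `^ p
        <= \sum_(B' in descendants B n) weight B' `^ p
        <= K2 * weight B `^ p.

Definition H3' : Prop :=
  forall k (B : cell C k) (B1 : cell C k.+1) (s : seq (cell C k.+1)),
    crossing_path B B1 s -> 1 <= horizontal_length B1 s.

End weights.
End graph.
End covering_theory.

(* Main.v *)
From Pilot Require Import Defs.
From HB Require Import structures.
From mathcomp Require Import all_boot all_order all_algebra.
From mathcomp Require Import all_classical all_reals all_analysis.
From mathcomp Require Import lra.
(* [root] and [center] are those of the covering, not of MathComp. *)
Import Pilot.Defs.

Set Implicit Arguments.
Unset Strict Implicit.
Unset Printing Implicit Defensive.

Import Order.TTheory GRing.Theory Num.Theory.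

Local Open Scope classical_set_scope.
Local Open Scope ring_scope.

(* Let pi^*(B) be the minimum of pi over the neighbours B' ~ B. Charge a
   horizontal edge the minimum of pi^* at its two ends and a vertical edge pi^*
   of its upper end; up to a factor 2, L_rho dominates this edge cost. A path of
   level at most k+1 can be pushed to level at most k without increasing the
   cost: cover its current level k+1 vertex by a cell D of level k and follow the
   path until it leaves 2 . D; this crossing costs at least pi^*(D) by (H3'),
   which pays for the horizontal edge from D to the next cell. Iterating down to
   level m+1, where m is maximal for c_4(x, y), moves the end points by less than
   4 kappa r_(m+1), so the ends of the final path differ, by maximality of m. Its
   last edge alone costs a fixed multiple of pi(c_4(x, y)), by (H1) and (H2). *)

Lemma in_ball (R : realType) (X : metricType R) (x y : X) (r : R) :
  ball x r y <-> mdist x y < r.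
Proof. by rewrite -metricType_numDomainType.ball_mdistE. Qed.

Lemma natr_le_expr (R : realType) (b : R) (n : nat) : 2 <= b -> n%:R <= b ^+ n.
Proof.
move=> b2; apply: (@le_trans _ _ (2 ^+ n)).
  by rewrite -natrX ler_nat ltnW // ltn_expl.
by apply: lerXn2r => //; rewrite nnegrE; lra.
Qed.

(** * Radii, centers and neighbouring cells *)

Section geometry.
Context {R : realType} {X : metricType R} {kappa lambda a : R}.
Variables (C : coverings X kappa a) (parent : forall n, cell C n.+1 -> cell C n).
Hypotheses (kappa1 : 1 <= kappa) (lambda32 : 32 <= lambda).
Hypothesis a_large : 6 * kappa ^+ 2 * lambda <= a.
Hypothesis parentP : parent_choice parent.

Lemma scale_ge192 : 192 <= a.
Proof.
apply: le_trans a_large; rewrite expr2.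
have k2 : 1 <= kappa * kappa by apply: mulr_ege1.
have : 1 * 32 <= kappa * kappa * lambda by apply: ler_pM => //; lra.
lra.
Qed.

Local Ltac section_lra :=
  move: kappa1 lambda32 scale_ge192; lra.

Lemma radius_gt0 n : 0 < a ^- n.
Proof. by rewrite invr_gt0 exprn_gt0 //; section_lra. Qed.

Lemma kappa_radius_gt0 n : 0 < kappa * a ^- n.
Proof. by rewrite mulr_gt0 ?radius_gt0 //; section_lra. Qed.

Lemma radiusS n : a ^- n = a * a ^- n.+1.
Proof. by rewrite exprS invfM mulrA divff ?mul1r //; apply/eqP; section_lra. Qed.

Lemma radius_shrinks n : 192 * (kappa * a ^- n.+1) <= kappa * a ^- n.
Proof.
rewrite [a ^- n]radiusS !mulrA ler_pM2r ?radius_gt0 //.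
rewrite mulrC ler_pM2l; section_lra.
Qed.

Lemma scaled_radius_shrinks n :
  6 * (lambda * kappa * a ^- n.+1) <= kappa * a ^- n.
Proof.
rewrite [a ^- n]radiusS !mulrA ler_pM2r ?radius_gt0 //.
apply: (@le_trans _ _ (6 * kappa ^+ 2 * lambda * kappa)); last first.
  by rewrite [leRHS]mulrC ler_pM2r //; section_lra.
rewrite ler_pM2r; last section_lra.
rewrite ler_pM2r; last section_lra.
by rewrite ler_peMr // expr2 mulr_ege1.
Qed.

Lemma carrier_exists n (x : X) : exists D : cell C n, carrier C D x.
Proof.
case: n => [|n].
  by exists (root C); rewrite (@carrier_root _ _ _ _ C).
have : (\bigcup_(B in [set: cell C n.+1]) carrier C B) x.
  by rewrite carrier_cover.
by move=> [D _ Dx]; exists D.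
Qed.

Lemma carrier_dist n (D : cell C n) x :
  carrier C D x -> mdist (center C D) x < kappa * a ^- n.
Proof.
case: n D => [D _|n D /carrier_sub_ball h].
  rewrite (rootP D) expr0 invr1 mulr1.
  by apply/in_ball; rewrite (@ball_root _ _ _ _ C).
by apply/in_ball; apply: h.
Qed.

(** A cell of level [n] whose carrier contains the center of [B] bounds the minimal distance, which
    the parent realizes. *)
Lemma parent_dist n (B : cell C n.+1) :
  mdist (center C B) (center C (parent B)) < kappa * a ^- n.
Proof.
rewrite (parentP B).
have [D /carrier_dist] := carrier_exists n (center C B).
rewrite metric_sym; apply: le_lt_trans.
rewrite /dist_to; apply: ge_inf.
  by exists 0 => _ [z _ <-]; exact: mdist_ge0.
by exists (center C D) => //; exists D.
Qed.

Lemma scaledE mu n (B : cell C n) x :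
  scaled mu B x <-> mdist (center C B) x < mu * (kappa * a ^- n).
Proof. by rewrite /scaled mulrA; exact: in_ball. Qed.

Lemma sim_common n (B B' : cell C n) z :
  scaled lambda B z -> scaled lambda B' z -> sim lambda B B'.
Proof. by move=> Bz B'z; apply/asboolP; exists z. Qed.

Lemma sim_refl n (B : cell C n) : sim lambda B B.
Proof.
have h : scaled lambda B (center C B).
  by apply/scaledE; rewrite mdistxx mulr_gt0 ?kappa_radius_gt0 //; section_lra.
exact: (sim_common h h).
Qed.

Lemma sim_sym n (B B' : cell C n) : sim lambda B B' -> sim lambda B' B.
Proof. by move=> /asboolP[z [h h']]; exact: (sim_common h' h). Qed.

Lemma sim_close n (B B' : cell C n) :
  mdist (center C B) (center C B') < 32 * (kappa * a ^- n) -> sim lambda B B'.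
Proof.
move=> h; apply: (@sim_common _ _ _ (center C B')); apply/scaledE.
  by apply: lt_le_trans h _; rewrite ler_pM2r ?kappa_radius_gt0.
by rewrite mdistxx mulr_gt0 ?kappa_radius_gt0 //; section_lra.
Qed.

(** Both centers are close to a common point: by the size of [a], the radius of [scaled lambda] at
    level [n.+1] is at most a sixth of [kappa * a ^- n]. *)
Lemma sim_dist n (B B' : cell C n.+1) : sim lambda B B' ->
  3 * mdist (center C B) (center C B') < kappa * a ^- n.
Proof.
move=> /asboolP[z []] /in_ball h /in_ball h'.
have := metric_triangle (center C B) z (center C B').
rewrite [mdist z _]metric_sym.
have := scaled_radius_shrinks n.
section_lra.
Qed.

(** * The maximal common level of two points *)

Lemma common_level_bound (alpha : R) (x y : X) : x <> y ->
  exists N, forall k, common_level C alpha x y k -> (k <= N)%N.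
Proof.
move=> /eqP xy; have d0 : 0 < mdist x y by rewrite mdist_gt0.
exists (Num.truncn (2 * alpha * kappa / mdist x y)) => k [B []].
move=> /scaledE h1 /scaledE h2.
have h := metric_triangle x (center C B) y.
rewrite [mdist x (center C B)]metric_sym in h.
have h3 : mdist x y < 2 * alpha * kappa * a ^- k by section_lra.
(* The sign of [alpha] is read off from [d0] and [h3]. *)
rewrite truncn_ge_nat; last first.
  have : 0 < 2 * alpha * kappa * a ^- k by section_lra.
  rewrite pmulr_lgt0 ?radius_gt0 // => h4.
  by rewrite divr_ge0 // ltW.
rewrite ler_pdivlMr //; apply: le_trans (_ : a ^+ k * mdist x y <= _).
  by rewrite ler_pM2r // natr_le_expr //; section_lra.
rewrite mulrC -ler_pdivlMr; first by rewrite ltW.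
by rewrite exprn_gt0 //; section_lra.
Qed.

Lemma max_common_levelP (alpha : R) (x y : X) : 1 <= alpha -> x <> y ->
  let m := max_common_level C alpha x y in
  common_level C alpha x y m /\
  forall k, common_level C alpha x y k -> (k <= m)%N.
Proof.
move=> alpha1 xy m.
suff : exists n, [set m | common_level C alpha x y m /\
    forall k, common_level C alpha x y k -> (k <= m)%N] n.
  exact: xgetPex.
have [N hN] := common_level_bound alpha xy.
pose P k := `[< common_level C alpha x y k >].
have P0 : exists k, P k.
  exists 0%N; apply/asboolP; exists (root C).
  have root_near z : scaled alpha (root C) z.
    apply/scaledE; rewrite expr0 invr1 mulr1.
    apply: (@lt_le_trans _ _ kappa); last by rewrite ler_peMl //; section_lra.
    by apply/in_ball; rewrite (@ball_root _ _ _ _ C).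
  by split; exact: root_near.
have PN k : P k -> (k <= N)%N by move=> /asboolP; exact: hN.
case: (ex_maxnP P0 PN) => n /asboolP Pn n_max.
by exists n; split=> // k Pk; apply: n_max; apply/asboolP.
Qed.

Lemma vtx_inj n : injective (@vtx _ _ _ _ C n).
Proof. by move=> B B' /eqP; rewrite eq_Tagged => /eqP. Qed.

(** * Weights and their minima over neighbours *)

Variable rho : vertex C -> R.
Hypotheses (rho_gt0 : forall v, 0 < rho v) (rho_le1 : forall v, rho v <= 1).

Local Notation weight := (@weight _ _ _ _ C parent rho _).

Lemma weightS n (B : cell C n.+1) :
  weight B = weight (parent B) * rho (vtx B).
Proof. by rewrite /Defs.weight /= -cats1 big_cat big_seq1. Qed.

Lemma weight_gt0 n (B : cell C n) : 0 < weight B.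
Proof. by apply: prodr_gt0. Qed.

Lemma weight_parent n (B : cell C n.+1) : weight B <= weight (parent B).
Proof. by rewrite weightS ler_piMr ?rho_le1 // ltW ?weight_gt0. Qed.

(* The telescoping weight pi^*: passing to a child costs exactly a factor
   [rho_star], so the descent below loses no multiplicative constant. *)
Definition star_weight n (B : cell C n) : R :=
  \big[Num.min/weight B]_(B' | sim lambda B' B) weight B'.

Lemma star_weight_le n (B B' : cell C n) :
  sim lambda B' B -> star_weight B <= weight B'.
Proof.
by move=> h; exact: (@bigmin_le_cond _ _ _ _ B' (fun A => sim lambda A B)).
Qed.

(** The default value [weight B] of the minimum is the term of [B] itself. *)
Lemma star_weight_ge n (B : cell C n) c :
  (forall B', sim lambda B' B -> c <= weight B') -> c <= star_weight B.
Proof. by move=> h; apply: le_bigmin => //; apply: h; exact: sim_refl. Qed.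

Lemma star_weight_ge0 n (B : cell C n) : 0 <= star_weight B.
Proof. by apply: star_weight_ge => B' _; rewrite ltW ?weight_gt0. Qed.

Lemma min_star_weight_ge0 n (B B' : cell C n) :
  0 <= Num.min (star_weight B) (star_weight B').
Proof. by rewrite le_min !star_weight_ge0. Qed.

(** For [B'] a neighbour of [B], the parent of [B'] is close enough to [D] to be its neighbour, and
    [weight B'] is the weight of that parent times [rho (vtx B')]. *)
Lemma star_weight_child n (D : cell C n) (B : cell C n.+1) :
  mdist (center C D) (center C B) < 4 * (kappa * a ^- n) ->
  star_weight D * rho_star lambda rho B <= star_weight B.
Proof.
move=> DB; apply: star_weight_ge => B' B'B; rewrite weightS.
apply: ler_pM.
- exact: star_weight_ge0.
- by apply: le_bigmin => [|A _]; rewrite ltW.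
- apply: star_weight_le; apply: sim_close.
  have := metric_triangle (center C (parent B')) (center C B') (center C D).
  have := metric_triangle (center C B') (center C B) (center C D).
  have := parent_dist B'; have := sim_dist B'B.
  rewrite [mdist (center C (parent B')) (center C B')]metric_sym.
  rewrite [mdist (center C B) (center C D)]metric_sym.
  by move: DB; have := kappa_radius_gt0 n; lra.
- exact: (@bigmin_le_cond _ _ _ _ B' (fun A => sim lambda A B)).
Qed.

(** * Cost of horizontal paths and of crossings *)

Definition star_length k (B1 : cell C k) (s : seq (cell C k)) : R :=
  \sum_(j < size s) Num.min (star_weight (nth B1 (B1 :: s) j))
                            (star_weight (nth B1 (B1 :: s) j.+1)).

Lemma star_length_ge0 k (B1 : cell C k) s : 0 <= star_length B1 s.
Proof. by apply: sumr_ge0 => j _; exact: min_star_weight_ge0. Qed.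

Lemma star_length_nil k (B1 : cell C k) : star_length B1 [::] = 0.
Proof. exact: big_ord0. Qed.

Lemma star_length_rcons k (B1 B : cell C k) s :
  star_length B1 (rcons s B) = star_length B1 s +
    Num.min (star_weight (last B1 s)) (star_weight B).
Proof.
have nthE i : (i <= size s)%N ->
    nth B1 (B1 :: rcons s B) i = nth B1 (B1 :: s) i.
  by move=> i_le; rewrite -rcons_cons nth_rcons ltnS i_le.
rewrite /star_length size_rcons big_ord_recr /= nthE // -last_nth.
rewrite nth_rcons ltnn eqxx; congr (_ + _); apply: eq_bigr => j _.
by rewrite nthE ?nth_rcons ?ltn_ord // ltnW.
Qed.

Hypothesis crossing : H3' lambda parent rho.

(** Term by term, [star_length] dominates [star_weight D] times [horizontal_length], which is at
    least 1. The constant 4 leaves room for the last cell, outside [2 . D]. *)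
Lemma crossing_star_length k (D : cell C k) (B1 : cell C k.+1) s :
  crossing_path lambda parent D B1 s ->
  (forall A, A \in B1 :: s ->
     mdist (center C D) (center C A) < 4 * (kappa * a ^- k)) ->
  star_weight D <= star_length B1 s.
Proof.
move=> /crossing h near.
apply: le_trans (_ : star_weight D * horizontal_length lambda rho B1 s <= _).
  by rewrite ler_peMr // star_weight_ge0.
rewrite mulr_sumr; apply: ler_sum => j _.
have child i : (i <= size s)%N -> star_weight D *
    rho_star lambda rho (nth B1 (B1 :: s) i) <= star_weight (nth B1 (B1 :: s) i).
  by move=> i_le; apply: star_weight_child; apply: near; apply: mem_nth.
rewrite le_min; apply/andP; split.
  apply: le_trans (child _ (ltnW (ltn_ord j))).
  by rewrite ler_wpM2l ?star_weight_ge0 // ge_min lexx.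
apply: le_trans (child _ (ltn_ord j)).
by rewrite ler_wpM2l ?star_weight_ge0 // ge_min lexx orbT.
Qed.

(** * Chains of vertices and their cost *)

(* [conn M u v c]: some chain of vertices of level at most M, each equal or
   adjacent to the next, joins u to v with total edge cost at most c. A vertical
   edge is charged at its upper end, which pays for one horizontal edge there. *)
Inductive conn (M : nat) (u : vertex C) : vertex C -> R -> Prop :=
| conn_refl c : (tag u <= M)%N -> 0 <= c -> conn M u u c
| conn_horizontal n (B B' : cell C n) c d :
    conn M u (vtx B) c -> sim lambda B B' ->
    c + Num.min (star_weight B) (star_weight B') <= d -> conn M u (vtx B') d
| conn_down n (B : cell C n.+1) c d :
    conn M u (vtx (parent B)) c -> (n < M)%N ->
    c + star_weight (parent B) <= d -> conn M u (vtx B) d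
| conn_up n (B : cell C n.+1) c d :
    conn M u (vtx B) c -> c + star_weight (parent B) <= d ->
    conn M u (vtx (parent B)) d.

Lemma conn_le M u v c d : conn M u v c -> c <= d -> conn M u v d.
Proof.
move=> h; case: v c / h => [c uM c0|n B B' c d' h s e|n B c d' h s e|n B c d' h e] cd.
- by apply: conn_refl => //; exact: le_trans cd.
- by apply: conn_horizontal h s _; exact: le_trans cd.
- by apply: conn_down h s _; exact: le_trans cd.
- by apply: conn_up h _; exact: le_trans cd.
Qed.

Lemma conn_level M u v c : conn M u v c -> (tag v <= M)%N.
Proof. by elim=> // n B c' d _ h _; exact: leq_trans h. Qed.

Lemma conn_ge0 M u v c : conn M u v c -> 0 <= c.
Proof.
elim=> // [n B B' c' d _ h _|n B c' d _ h _|n B c' d _ h]; apply: le_trans.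
- by rewrite addr_ge0 // min_star_weight_ge0.
- by rewrite addr_ge0 // star_weight_ge0.
- by rewrite addr_ge0 // star_weight_ge0.
Qed.

(** * Coarsening a chain by one level *)

(* State of the coarsening after a chain of level at most k+1 has been read up
   to v. If v has level k+1, the chain read since the last visit to level k, or
   since the last exit from a doubled cell, stays in 2 . D. *)
Definition scanned k (u v : vertex C) (c : R) : Prop :=
  ((tag v <= k)%N -> conn k u v c) /\
  forall B : cell C k.+1, v = vtx B ->
  exists (D : cell C k) (B1 : cell C k.+1) (s : seq (cell C k.+1)) (c1 : R),
    [/\ conn k u (vtx D) c1, c1 + star_length B1 s <= c, last B1 s = B
      & [/\ horizontal_path lambda parent B1 s, carrier C D (center C B1)
          & forall A, A \in B1 :: s -> scaled 2 D (center C A)]].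

Lemma scanned_le k u v c d : scanned k u v c -> c <= d -> scanned k u v d.
Proof.
move=> [h1 h2] cd; split=> [vk|B vB]; first exact: conn_le (h1 vk) cd.
have [D [B1 [s [c1 [uD le_c lastB h]]]]] := h2 B vB.
by exists D, B1, s, c1; split=> //; exact: le_trans cd.
Qed.

Lemma carrier_scaled2 n (D : cell C n) x : carrier C D x -> scaled 2 D x.
Proof.
move=> /carrier_dist h; apply/scaledE.
by have := kappa_radius_gt0 n; move: h; lra.
Qed.

Lemma scanned_start k u (D : cell C k) (B : cell C k.+1) c :
  conn k u (vtx D) c -> carrier C D (center C B) -> scanned k u (vtx B) c.
Proof.
move=> uD DB; split=> [|B' /vtx_inj <-]; first by rewrite ltnn.
exists D, B, [::], c; rewrite star_length_nil addr0; split=> //; split=> // A.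
by rewrite inE => /eqP ->; exact: carrier_scaled2.
Qed.

Lemma sim_carrier_parent n (D : cell C n) (B : cell C n.+1) :
  scaled 2 D (center C B) -> sim lambda D (parent B).
Proof.
move=> /scaledE DB; apply: sim_close.
have := metric_triangle (center C D) (center C B) (center C (parent B)).
by have := parent_dist B; have := kappa_radius_gt0 n; move: DB; lra.
Qed.

(** Either [B'] prolongs the segment inside [2 . D], or the prolonged segment is a crossing whose
    cost pays for one horizontal step from [D] to a cell containing the center of [B']. *)
Lemma scanned_horizontal k u (B B' : cell C k.+1) c :
  scanned k u (vtx B) c -> sim lambda B B' ->
  scanned k u (vtx B') (c + Num.min (star_weight B) (star_weight B')).
Proof.
move=> scB BB'; have cost := min_star_weight_ge0 B B'.
(* [sim] is reflexive, but an edge of [Zd] has distinct ends. *)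
have [<-|BneB'] := eqVneq B B'.
  by apply: scanned_le scB _; rewrite lerDl min_star_weight_ge0.
have [D [B1 [s [c1 [uD le_c lastB [hs DB1 in2D]]]]]] := scB.2 B erefl.
have hs' : horizontal_path lambda parent B1 (rcons s B').
  rewrite /horizontal_path map_rcons rcons_path; apply/andP; split=> //.
  rewrite last_map lastB; apply/asboolP; left; split.
    by move=> /vtx_inj /eqP; apply/negP.
  by exists k.+1, B, B'.
have le_c' : c1 + star_length B1 (rcons s B') <=
    c + Num.min (star_weight B) (star_weight B').
  by rewrite star_length_rcons lastB addrA lerD2r.
have DB : scaled 2 D (center C B) by apply: in2D; rewrite -lastB mem_last.
have := DB => /scaledE DBlt; have BB'lt := sim_dist BB'.
have DB'lt := metric_triangle (center C D) (center C B) (center C B').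
have rk := kappa_radius_gt0 k.
have [DB'|DB'] := pselect (scaled 2 D (center C B')).
  split=> [|B0 /vtx_inj <-]; first by rewrite ltnn.
  exists D, B1, (rcons s B'), c1; split=> //; first by rewrite last_rcons.
  split=> // A; rewrite -rcons_cons mem_rcons inE => /orP[/eqP -> //|].
  exact: in2D.
(* First exit from [2 . D]: the segment is now in the crossing family of [D]. *)
have Dcost : star_weight D <= star_length B1 (rcons s B').
  apply: crossing_star_length; last first.
    move=> A; rewrite -rcons_cons mem_rcons inE => /orP[/eqP ->|/in2D].
      by move: DBlt BB'lt DB'lt rk; lra.
    by move=> /scaledE; move: rk; lra.
  split=> // [i i_gt0|]; last by rewrite last_rcons.
  rewrite -rcons_cons size_rcons ltnS => i_lt.
  by rewrite nth_rcons i_lt; apply: in2D; exact: mem_nth.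
have [D' D'B'] := carrier_exists k (center C B').
apply: (scanned_start _ D'B'); apply: conn_horizontal uD _ _; last first.
  apply: le_trans le_c'; rewrite lerD2l; apply: le_trans Dcost.
  by rewrite ge_min lexx.
apply: sim_close.
have := metric_triangle (center C D) (center C B') (center C D').
have := carrier_dist D'B'.
rewrite [mdist (center C B') _]metric_sym.
by move: DBlt BB'lt DB'lt rk; lra.
Qed.

(** The coarse chain may start at [u] instead of [u0], so that a start of level [k.+1] can be
    replaced by a cell of level [k]. *)
Lemma scan k u0 u v c :
  conn k.+1 u0 v c -> scanned k u u0 0 -> scanned k u v c.
Proof.
move=> + start; elim=> [c' _ c'0|n B B' c' d h IH BB' le_d|
    n B c' d _ IH nk le_d|n B c' d h IH le_d].
- exact: scanned_le start c'0.
- apply: scanned_le le_d; have [nk|kn] := leqP n k.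
    split=> [_|B0 /(congr1 tag) /= nE]; last by exfalso; move: nk; rewrite nE ltnn.
    exact: conn_horizontal (IH.1 nk) BB' _.
  have nE : n = k.+1. by apply/eqP; rewrite eqn_leq kn (conn_level h).
  by subst n; exact: scanned_horizontal.
- have := IH.1 nk => uB.
  have [nE|nk'] := eqVneq n k; last first.
    split=> [_|B0 /(congr1 tag) /= [nE]]; last by exfalso; move: nk'; rewrite nE eqxx.
    apply: conn_down uB _ le_d.
    by rewrite ltn_neqAle nk' -ltnS.
  (* The step down becomes a horizontal step from the parent to [D], at no greater cost, and a new
     segment opens. *)
  subst n; have [D DB] := carrier_exists k (center C B).
  apply: (scanned_start (D := D)) => //.
  apply: conn_horizontal uB (sim_sym (sim_carrier_parent (carrier_scaled2 DB))) _.
  by apply: le_trans le_d; rewrite lerD2l ge_min lexx.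
- have := conn_level h; rewrite /= ltnS => nk.
  split=> [_|B0 /(congr1 tag) /= nE]; last by exfalso; move: nk; rewrite nE ltnn.
  have [nE|nk'] := eqVneq n k; last first.
    apply: conn_up le_d; apply: IH.1.
    by rewrite /= ltn_neqAle nk' nk.
  (* The segment is dropped; the step up becomes a horizontal step from [D] to the parent. *)
  subst n; have [D [B1 [s [c1 [uD le_c lastB [_ _ in2D]]]]]] := IH.2 B erefl.
  apply: conn_horizontal uD (sim_carrier_parent _) _.
    by apply: in2D; rewrite -lastB mem_last.
  apply: le_trans le_d; apply: lerD; last by rewrite ge_min lexx orbT.
  by apply: le_trans le_c; rewrite lerDl star_length_ge0.
Qed.

(** * Descending through the levels *)

Lemma conn_lower k u v c :
  (tag u <= k)%N -> (tag v <= k)%N -> conn k.+1 u v c -> conn k u v c.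
Proof.
move=> uk vk uv; apply: (scan uv _).1 => //.
split=> [_|B uB]; first exact: conn_refl.
by exfalso; move: uk; rewrite uB ltnn.
Qed.

Lemma conn_lower_to n u v c j :
  (tag u <= n)%N -> (tag v <= n)%N -> conn (j + n) u v c -> conn n u v c.
Proof.
move=> un vn; elim: j => // j IH h; apply: IH.
by apply: conn_lower h; rewrite (leq_trans _ (leq_addl j n)).
Qed.

(** The start is replaced by a cell containing its center, the end by the cell whose double holds
    the last segment. *)
Lemma conn_coarsen k (B B' : cell C k.+1) c : conn k.+1 (vtx B) (vtx B') c ->
  exists D D' : cell C k,
    [/\ conn k (vtx D) (vtx D') c,
        mdist (center C D) (center C B) < 2 * (kappa * a ^- k)
      & mdist (center C D') (center C B') < 2 * (kappa * a ^- k)].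
Proof.
move=> BB'; have [D DB] := carrier_exists k (center C B).
have start : scanned k (vtx D) (vtx B) 0.
  by apply: (scanned_start _ DB); exact: conn_refl.
have [D' [B1 [s [c1 [DD' le_c lastB' [_ _ in2D']]]]]] :=
  (scan BB' start).2 B' erefl.
exists D, D'; split.
- by apply: conn_le DD' _; apply: le_trans le_c; rewrite lerDl star_length_ge0.
- exact/scaledE/carrier_scaled2.
- by apply/scaledE; apply: in2D'; rewrite -lastB' mem_last.
Qed.

(* The drift at level i is below 2 kappa r_i <= 3 kappa (r_i - r_(i+1)), which
   telescopes. *)
Lemma conn_coarsen_to l j (B B' : cell C (j + l)) c :
  conn (j + l) (vtx B) (vtx B') c ->
  exists A A' : cell C l,
    [/\ conn l (vtx A) (vtx A') c,
        mdist (center C A) (center C B)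
          <= 3 * (kappa * a ^- l) - 3 * (kappa * a ^- (j + l))
      & mdist (center C A') (center C B')
          <= 3 * (kappa * a ^- l) - 3 * (kappa * a ^- (j + l))].
Proof.
elim: j B B' => [|j IH] B B' BB'.
  by exists B, B'; rewrite !mdistxx subrr.
have [D [D' [DD' DB D'B']]] := conn_coarsen BB'.
have [A [A' [AA' AD A'D']]] := IH D D' DD'.
have rj : 192 * (kappa * a ^- (j.+1 + l)) <= kappa * a ^- (j + l).
  exact: radius_shrinks.
have rj1 := kappa_radius_gt0 (j.+1 + l).
exists A, A'; split=> //.
  have := metric_triangle (center C A) (center C D) (center C B).
  by move: DB AD rj rj1; lra.
have := metric_triangle (center C A') (center C D') (center C B').
by move: D'B' A'D' rj rj1; lra.
Qed.

(** * From edge paths to chains *)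

Local Notation rho_length := (@rho_length _ _ _ _ C parent rho).

Lemma path_conn M u s : path (Zd lambda parent) u s ->
  (forall v, v \in u :: s -> (tag v <= M)%N) ->
  conn M u (last u s) (2 * rho_length u s).
Proof.
move=> us levels.
(* Withholding one copy of the last weight makes the budget grow, at each new edge, by the sum of
   the weights of its two ends. *)
suff h : conn M u (last u s) (2 * rho_length u s - weight (tagged (last u s))).
  by apply: conn_le h _; rewrite gerBl ltW ?weight_gt0.
elim/last_ind: s us levels => [_ levels|s v IH].
  apply: conn_refl; first by apply: levels; rewrite mem_head.
  rewrite /Defs.rho_length big_seq1 /=.
  by have := weight_gt0 (tagged u); lra.
rewrite rcons_path => /andP[us /asboolP uv] levels.
have tv : (tag v <= M)%N by apply: levels; rewrite inE mem_rcons mem_head orbT.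
have {us} := IH us _.
have -> : rho_length u (rcons s v) = rho_length u s + weight (tagged v).
  by rewrite /Defs.rho_length -rcons_cons -cats1 big_cat big_seq1.
rewrite last_rcons => {}IH.
have {}IH : conn M u (last u s)
    (2 * rho_length u s - weight (tagged (last u s))).
  apply: IH => w ws; apply: levels.
  by rewrite -rcons_cons mem_rcons inE ws orbT.
move: IH uv tv; set L := rho_length u s.
move: (last u s) => w IH [[_ [n [B [B' [wE vE BB']]]]]|[[n [B [wE vE]]]|
  [n [B [vE wE]]]]]; move: IH; rewrite wE vE /= => IH nM.
- apply: conn_horizontal IH BB' _.
  have : Num.min (star_weight B) (star_weight B') <= weight B.
    by rewrite ge_min star_weight_le // sim_refl.
  by have := weight_gt0 B'; lra.
- apply: conn_up IH _.
  have := star_weight_le (sim_refl (parent B)).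
  by have := weight_gt0 B; lra.
- apply: conn_down IH nM _.
  have := star_weight_le (sim_refl (parent B)).
  by have := weight_gt0 B; lra.
Qed.

(** * Lower bound for the cost of a chain between distinct vertices *)

Variable K0 : R.
Hypothesis K0_ge1 : 1 <= K0.
Hypothesis weight_sim :
  forall n (B B' : cell C n), sim lambda B B' -> weight B <= K0 * weight B'.

Lemma weight_le_star n (B : cell C n) : weight B <= K0 * star_weight B.
Proof.
have K0_gt0 : 0 < K0 by apply: lt_le_trans K0_ge1.
rewrite mulrC -ler_pdivrMr //; apply: star_weight_ge => B' B'B.
by rewrite ler_pdivrMr // mulrC; apply: weight_sim; exact: sim_sym.
Qed.

(** As [u <> v], the chain has a last step, whose cost alone suffices. *)
Lemma conn_weight M u v c :
  conn M u v c -> u <> v -> weight (tagged v) <= K0 ^+ 2 * c.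
Proof.
have K0_ge0 : 0 <= K0 by apply: le_trans K0_ge1.
have step b c0 d : 0 <= c0 -> c0 + b <= d -> forall x,
    x <= K0 ^+ 2 * b -> x <= K0 ^+ 2 * d.
  move=> c0_ge0 le_d x /le_trans; apply; rewrite ler_wpM2l ?exprn_ge0 //.
  by apply: le_trans le_d; rewrite lerDr.
have K0_step x y : 0 <= y -> x <= K0 * y -> x <= K0 ^+ 2 * y.
  move=> y0 /le_trans; apply; rewrite expr2 -mulrA ler_peMl //.
  by rewrite mulr_ge0.
case=> // [n B B' c0 d h BB' le_d|n B c0 d h _ le_d|n B c0 d h le_d] _ /=;
  apply: step (conn_ge0 h) le_d _ _.
(* If the minimum is at [B], one factor [K0] passes from [B'] to [B], the other from [weight B] to
   [star_weight B]. *)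
- rewrite minEle; case: ifP => _.
    rewrite expr2 -mulrA; apply: (@le_trans _ _ (K0 * weight B)).
      by apply: weight_sim; exact: sim_sym.
    by rewrite ler_wpM2l // weight_le_star.
  by apply: K0_step; rewrite ?star_weight_ge0 ?weight_le_star.
- apply: le_trans (weight_parent B) _.
  by apply: K0_step; rewrite ?star_weight_ge0 ?weight_le_star.
- by apply: K0_step; rewrite ?star_weight_ge0 ?weight_le_star.
Qed.

(** * Lower bound for joining paths *)

Variable eta : R.
Hypotheses (eta_gt0 : 0 < eta) (eta_le : forall v, eta <= rho v).

(** The factor 2 comes from [path_conn], two powers of [K0] from [conn_weight], the third from
    comparing a cell of [c_4(x, y)] with the parent of [A'], and [eta] from passing to [A']. *)
Lemma joining_path_length (x y : X) n u s : x <> y ->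
  (max_common_level C 4 x y < n)%N -> joining_path lambda parent n x y u s ->
  eta * weight_common parent rho 4 x y <= 2 * K0 ^+ 3 * rho_length u s.
Proof.
move=> xy; have [] := max_common_levelP (ler1n _ 4) xy.
set m := max_common_level _ _ _ _ => _ m_max mn [us [B [B' [uE lastE Bx B'y]]]].
have [A [A' [AA' Ax A'y]]] : exists A A' : cell C m.+1,
    [/\ conn m.+1 (vtx A) (vtx A') (2 * rho_length u s),
        mdist (center C A) x < 4 * (kappa * a ^- m.+1)
      & mdist (center C A') y < 4 * (kappa * a ^- m.+1)].
  have uB : conn n (vtx B) (vtx B') (2 * rho_length u s).
    (* The path may visit levels beyond [n]; lowering from its greatest level to [n] keeps its
       ends. *)
    pose M := \max_(v <- u :: s) tag v.
    have uM v : v \in u :: s -> (tag v <= M)%N.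
      by move=> vs; exact: (@leq_bigmax_seq _ _ xpredT (fun v => tag v)).
    have := path_conn us uM; rewrite lastE uE.
    have nM : (n <= M)%N by have := uM u (mem_head _ _); rewrite uE.
    by rewrite -(subnK nM); exact: conn_lower_to.
  move: B B' Bx B'y uE lastE uB; rewrite -(subnK mn).
  move: (n - m.+1)%N => j.
  move=> B B' /carrier_dist Bx /carrier_dist B'y _ _.
  move=> /conn_coarsen_to[A [A' [AA' AB A'B']]].
  have r1 := kappa_radius_gt0 (j + m.+1); have r2 := kappa_radius_gt0 m.+1.
  exists A, A'; split=> //.
    have := metric_triangle (center C A) (center C B) x.
    move: AB Bx r1 r2.
    by move: (kappa * a ^- m.+1) (kappa * a ^- (j + m.+1)) => r r'; lra.
  have := metric_triangle (center C A') (center C B') y.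
  move: A'B' B'y r1 r2.
  by move: (kappa * a ^- m.+1) (kappa * a ^- (j + m.+1)) => r r'; lra.
(* Equality would make [m.+1] a common level, against the maximality of [m]. *)
have AneA' : vtx A <> vtx A'.
  move=> /vtx_inj AE; have : common_level C 4 x y m.+1.
    by exists A; split; apply/scaledE => //; rewrite AE.
  by move=> /m_max; rewrite ltnn.
have K0_gt0 : 0 < K0 by apply: lt_le_trans K0_ge1.
have A'_le := conn_weight AA' AneA'; rewrite /= in A'_le.
rewrite mulrC -ler_pdivlMr //.
have L_ge0 : 0 <= rho_length u s.
  by have := conn_ge0 AA'; rewrite pmulr_rge0.
(* The first goal concerns the default value 0 of the maximum, whence [L_ge0]. *)
apply: bigmax_le => [|E /asboolP[_ Ey]].
  by rewrite divr_ge0 ?(ltW eta_gt0) // !mulr_ge0 ?exprn_ge0 ?(ltW K0_gt0).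
have EA' : sim lambda E (parent A').
  apply: (@sim_common _ _ _ y); apply/scaledE.
    move: Ey => /scaledE /lt_le_trans; apply.
    by rewrite ler_pM2r ?kappa_radius_gt0 //; section_lra.
  apply: (@lt_le_trans _ _ (32 * (kappa * a ^- m))); last first.
    by rewrite ler_pM2r ?kappa_radius_gt0.
  have := metric_triangle (center C (parent A')) (center C A') y.
  have := parent_dist A'; rewrite [mdist (center C A') (center _ _)]metric_sym.
  have := radius_shrinks m; have := kappa_radius_gt0 m.
  move: A'y.
  by move: (kappa * a ^- m.+1) (kappa * a ^- m) => r r'; lra.
rewrite ler_pdivlMr //; apply: (@le_trans _ _ (K0 * weight A')).
  apply: (@le_trans _ _ (K0 * weight (parent A') * eta)).
    by rewrite ler_wpM2r ?weight_sim // ltW.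
  rewrite -mulrA weightS ler_wpM2l ?(ltW K0_gt0) //.
  by rewrite ler_wpM2l ?(ltW (weight_gt0 _)).
apply: le_trans (_ : K0 * (K0 ^+ 2 * (2 * rho_length u s)) <= _).
  by rewrite ler_wpM2l // ltW.
by rewrite mulrA -exprS mulrCA mulrA.
Qed.

End geometry.

Theorem proposition2p10 (R : realType) (X : metricType R)
    (KP kappa lambda a : R) (C : coverings X kappa a)
    (parent : forall n, cell C n.+1 -> cell C n)
    (p : R) (rho : vertex C -> R) :
  compact [set: X] ->
  (exists x y : X, x <> y) ->
  doubling X ->
  1 < KP -> uniformly_perfect X KP ->
  1 <= kappa -> 32 <= lambda ->
  6 * kappa ^+ 2 * Num.max lambda KP <= a ->
  parent_choice parent ->
  0 < p ->
  (forall v : vertex C, 0 < rho v) ->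
  H1 rho ->
  H2 lambda parent rho ->
  H4 parent rho p ->
  H3' lambda parent rho ->
  H3 lambda parent rho.
Proof.
move=> _ _ _ _ _ kappa1 lambda32 a_max parentP _ rho_gt0.
move=> [eta [eta' [eta_gt0 eta_le eta'_lt1 rho_eta]]] [K0 [K0_ge1 K0P]] _ cross.
have a_large : 6 * kappa ^+ 2 * lambda <= a.
  apply: le_trans a_max; rewrite ler_wpM2l ?le_max ?lexx //.
  by rewrite mulr_ge0 // exprn_ge0 //; lra.
have rho_ge v : eta <= rho v by case/andP: (rho_eta v).
have rho_le1 v : rho v <= 1 by case/andP: (rho_eta v) => _; lra.
have K0_3 : 1 <= K0 ^+ 3 by exact: exprn_ege1.
(* With [alpha] equal to 4, [4 . A] absorbs the total drift, below [3 * kappa * a ^- m.+1], and 4 is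
   at most [lambda / 4] as [lambda >= 32]. *)
exists 4, (2 * K0 ^+ 3 / eta); split; [lra|lra| |move=> x y xy].
  by rewrite ler_pdivlMr //; lra.
(* From this level on, paths can be coarsened to level [m.+1]. *)
exists (max_common_level C 4 x y).+1; split=> // n u s mn us.
rewrite invf_div mulrAC ler_pdivrMr; last lra.
rewrite [leRHS]mulrC.
exact: (joining_path_length kappa1 lambda32 a_large parentP rho_gt0 rho_le1
  cross K0_ge1 K0P eta_gt0 rho_ge xy mn us).
Qed.
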